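(* For every $n\ge1$, the poset, under the painted growth order, of painted trees with $n+1$ leaves consisting of weakly ordered forests grafted to corollas is isomorphic to the face poset of the stellohedron $\mathcal{K}St_n$, i.e. to the poset $\mathrm{Tub}(St_n)$ of tubings of the star graph $St_n$.
   Context: **Tubings.** For a finite connected simple graph $G$, a tube is a nonempty set of nodes inducing a connected subgraph; the set of all nodes is the universal tube. Two tubes $u,v$ are compatible if one is contained in the other or if $u\cup v$ is not a tube (and $u,v$ disjoint). A tubing is a set of pairwise compatible tubes containing the universal tube. $\mathrm{Tub}(G)$ is the set of tubings ordered by $U\preceq U'$ iff $U'\subseteq U$; it is the face poset of the graph associahedron $\mathcal{K}G$. The star graph $St_n$ has nodes $0,1,\dots,n$ and edges $\{0,i\}$, $1\le i\le n$. **Plane and painted trees.** A plane tree is a finite rooted plane tree in which every node has at least two (linearly ordered) inputs; inputs not coming from another node are leaves, numbered $0,1,\dots,n$ from left to right; the root has an output edge. A node $w$ is strictly above a node $v$ if $v\neq w$ lies on the path from $w$ to the root. A weak order on a set of nodes is a total preorder (an ordered partition into levels), always required to satisfy: if $w$ is strictly above $v$ then the level of $w$ comes strictly after the level of $v$. A painted tree is a plane tree each of whose nodes is declared painted, half-painted or unpainted, such that if $w$ is strictly above $v$ and $v$ is half-painted or unpainted, then $w$ is unpainted. Let $W_n$ be the set of painted trees with $n+1$ leaves equipped with a weak order on the painted nodes and a weak order on all unpainted nodes. A weakly ordered forest grafted to a corolla is a painted tree with at most one painted node, equipped with a weak order on the set of all unpainted nodes; let $X_n$ be the set of those with $n+1$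 leaves. The forgetful map $p:W_n\to X_n$ forgets the weak order of the painted nodes and contracts every edge joining two painted nodes. **Painted growth order.** For $t\in W_n$, gap $i$ ($1\le i\le n$) ends at the node where the paths from leaves $i-1$ and $i$ to the root first meet. $\pi(t)$ is the ordered partition of $\{0,\dots,n\}$ listing: in order, the blocks of gaps ending at painted nodes of each level; then the block of $0$ and all gaps ending at half-painted nodes; then, in order, the blocks of gaps ending at unpainted nodes of each level. $\pi(s)$ refines $\pi(t)$ if it is obtained by replacing each block by an ordered partition of that block. A growth step in $X_n$ (growing internal edges, then forgetting superfluous structure) passes from $x$ to $y$ if there are $t,s\in W_n$ with $p(t)=x$, $p(s)=y$ and $\pi(s)$ refining $\pi(t)$. Then $y\preceq x$ iff $y$ is obtained from $x$ by a finite (possibly empty) sequence of growth steps. *)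

(* Defs.v *)
From Stdlib Require Import Relation_Operators.
From HB Require Import structures.
From mathcomp Require Import all_boot.

Set Implicit Arguments.
Unset Strict Implicit.
Unset Printing Implicit Defensive.

Definition connected_in (T : finType) (e : rel T) (u : {set T}) : bool :=
  (u != set0) &&
  [forall x in u, forall y in u,
     connect [rel a b | [&& a \in u, b \in u & e a b]] x y].

Record graph : Type := Graph {
  vertex :> finType;
  adj : rel vertex;
  adj_sym : symmetric adj;
  adj_irr : irreflexive adj;
  adj_connected : connected_in adj [set: vertex]
}.

Definition tube (G : graph) (u : {set G}) : bool := connected_in (@adj G) u.

Definition compatible (G : graph) (u v : {set G}) : bool :=
  [|| u \subset v, v \subset u | [disjoint u & v] && ~~ tube (u :|: v)].

Definition tubing (G : graph) (U : {set {set G}}) : bool :=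
  [&& [set: G] \in U,
      [forall u in U, tube u] &
      [forall u in U, forall v in U, compatible u v]].

Definition Tub (G : graph) : Type := {U : {set {set G}} | tubing U}.

Definition tub_le (G : graph) (U U' : Tub G) : Prop := val U' \subset val U.

Definition star_adj (n : nat) : rel 'I_n.+1 :=
  [rel i j | (i == ord0) && (j != ord0) || (i != ord0) && (j == ord0)].

Lemma star_adj_sym n : symmetric (@star_adj n).
Proof.
move=> i j; rewrite /star_adj /= orbC.
by rewrite [in X in X || _]andbC [in X in _ || X]andbC.
Qed.

Lemma star_adj_irr n : irreflexive (@star_adj n).
Proof. by move=> i; rewrite /star_adj /=; case: eqP. Qed.

Lemma star_adj_connected n : connected_in (@star_adj n) [set: 'I_n.+1].
Proof.
apply/andP; split; first by apply/set0Pn; exists ord0; rewrite inE.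
apply/forall_inP => x _; apply/forall_inP => y _.
apply: (@connect_trans _ _ ord0).
- have [->|x0] := eqVneq x ord0; first exact: connect0.
  by apply: connect1; rewrite /star_adj /= !inE x0 eqxx orbT.
- have [->|y0] := eqVneq y ord0; first exact: connect0.
  by apply: connect1; rewrite /star_adj /= !inE y0.
Qed.

Definition St (n : nat) : graph :=
  Graph (@star_adj_sym n) (@star_adj_irr n) (@star_adj_connected n).

(** Unpainted nodes always carry the index of their level in the weak order of
    the unpainted nodes; painted nodes carry a [P], which is their level
    ([P = nat]) or nothing ([P = unit]). *)
Inductive label (P : Type) : Type :=
  Painted of P | HalfPainted | Unpainted of nat.
Arguments HalfPainted {P}.
Arguments Unpainted {P} _.

Definition label_code (P : Type) (l : label P) : option (P + nat) :=
  match l with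
  | Painted p => Some (inl p) | HalfPainted => None | Unpainted k => Some (inr k)
  end.

Definition label_decode (P : Type) (c : option (P + nat)) : label P :=
  match c with
  | Some (inl p) => Painted p | None => HalfPainted | Some (inr k) => Unpainted k
  end.

Lemma label_codeK (P : Type) : cancel (@label_code P) (@label_decode P).
Proof. by case. Qed.

HB.instance Definition _ (P : eqType) :=
  Equality.copy (label P) (can_type (@label_codeK P)).

Definition is_painted (P : Type) (l : label P) : bool :=
  if l is Painted _ then true else false.

Definition is_unpainted (P : Type) (l : label P) : bool :=
  if l is Unpainted _ then true else false.

Definition painted_level (l : label nat) : option nat :=
  if l is Painted k then Some k else None.

Definition unpainted_level (P : Type) (l : label P) : option nat :=
  if l is Unpainted k then Some k else None.

Inductive tree (P : Type) : Type :=
  Leaf | Node of label P & seq (tree P).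
Arguments Leaf {P}.

Fixpoint plane (P : Type) (t : tree P) : bool :=
  if t is Node _ ts then (1 < size ts) && all (@plane P) ts else true.

Definition indexed (A : Type) (s : seq A) : seq (nat * A) :=
  zip (iota 0 (size s)) s.

(** A node or leaf is identified with its address: the sequence of input
    positions followed on the path from the root up to it. *)
Definition address := seq nat.

Fixpoint leaves (P : Type) (t : tree P) : seq address :=
  if t is Node _ ts then
    flatten [seq [seq c.1 :: a | a <- c.2] | c <- indexed (map (@leaves P) ts)]
  else [:: [::]].

Fixpoint nodes (P : Type) (t : tree P) : seq (address * label P) :=
  if t is Node l ts then
    ([::], l) ::
    flatten [seq [seq (c.1 :: v.1, v.2) | v <- c.2]
            | c <- indexed (map (@nodes P) ts)]
  else [::].

Definition strictly_above (w v : address) : bool := prefix v w && (v != w).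

Definition upward (P : Type) (r : rel (label P)) (t : tree P) : bool :=
  all (fun v => all (fun w => strictly_above w.1 v.1 ==> r v.2 w.2) (nodes t))
      (nodes t).

Definition painted_tree (P : Type) (t : tree P) : bool :=
  plane t && upward (fun l l' => is_painted l || is_unpainted l') t.

Definition levels (P : Type) (lev : label P -> option nat) (t : tree P) :
    seq nat :=
  pmap (fun v => lev v.2) (nodes t).

Definition nb_levels (P : Type) (lev : label P -> option nat) (t : tree P) :
    nat :=
  size (undup (levels lev t)).

(** The nodes on which [lev] is defined are weakly ordered by [lev]. The level
    indices are required to be exactly [0, ..., m-1], so that each ordered
    partition into levels has a unique encoding. *)
Definition weak_order (P : Type) (lev : label P -> option nat) (t : tree P) :
    bool :=
  perm_eq (undup (levels lev t)) (iota 0 (nb_levels lev t)) &&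
  upward (fun l l' => match lev l, lev l' with
                      | Some i, Some j => i < j
                      | _, _ => true
                      end) t.

Definition in_W (n : nat) (t : tree nat) : bool :=
  [&& size (leaves t) == n.+1, painted_tree t,
      weak_order painted_level t & weak_order (@unpainted_level nat) t].

Definition in_X (n : nat) (t : tree unit) : bool :=
  [&& size (leaves t) == n.+1, painted_tree t,
      count (fun v => is_painted v.2) (nodes t) <= 1 &
      weak_order (@unpainted_level unit) t].

Definition W (n : nat) : Type := {t : tree nat | in_W n t}.

Definition X (n : nat) : Type := {t : tree unit | in_X n t}.

(** A painted input of a painted node is replaced by its own inputs, which
    contracts the edge between them. *)
Fixpoint forget (t : tree nat) : tree unit :=
  match t with
  | Leaf => Leaf
  | Node (Painted _) ts =>
      Node (Painted tt)
        (flatten [seq (if u is Node (Painted _) us then us else [:: u])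
                 | u <- map forget ts])
  | Node HalfPainted ts => Node HalfPainted (map forget ts)
  | Node (Unpainted k) ts => Node (Unpainted k) (map forget ts)
  end.

Fixpoint common_prefix (a b : address) : address :=
  match a, b with
  | i :: a', j :: b' => if i == j then i :: common_prefix a' b' else [::]
  | _, _ => [::]
  end.

(** The nodes on the path from a leaf to the root are the proper prefixes of the
    address of the leaf, so two such paths first meet at the longest common
    prefix. *)
Definition gap_end (P : Type) (t : tree P) (i : nat) : address :=
  common_prefix (nth [::] (leaves t) i.-1) (nth [::] (leaves t) i).

Definition gaps_ending (n : nat) (t : tree nat) (l : label nat) :
    {set 'I_n.+1} :=
  [set i : 'I_n.+1 | (0 < i) && ((gap_end t i, l) \in nodes t)].

Definition growth_partition (n : nat) (t : tree nat) : seq {set 'I_n.+1} :=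
  [seq gaps_ending n t (Painted k) | k <- iota 0 (nb_levels painted_level t)]
  ++ (ord0 |: gaps_ending n t HalfPainted)
  :: [seq gaps_ending n t (Unpainted k)
     | k <- iota 0 (nb_levels (@unpainted_level nat) t)].

Definition ordered_partition (T : finType) (s : seq {set T}) (B : {set T}) :
    bool :=
  uniq s && partition [set:: s] B.

Definition refines (T : finType) (s t : seq {set T}) : Prop :=
  exists2 r : seq (seq {set T}),
    s = flatten r & all2 (@ordered_partition T) r t.

Definition growth_step (n : nat) (x y : X n) : Prop :=
  exists t s : W n,
    [/\ forget (val t) = val x, forget (val s) = val y &
        refines (growth_partition n (val s)) (growth_partition n (val t))].

Definition growth_le (n : nat) (y x : X n) : Prop :=
  clos_refl_trans (X n) (@growth_step n) x y.

Definition poset_isomorphic (A B : Type) (leA : A -> A -> Prop)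
    (leB : B -> B -> Prop) : Prop :=
  exists2 f : A -> B, bijective f & forall a a', leA a a' <-> leB (f a) (f a').

(* Main.v *)
(** Reading the gaps of a leveled plane tree from left to right and recording the
    label of the node where each gap ends gives a word; the tree is recovered
    from its word by splitting repeatedly at the least label, and forgetting the
    painted structure forgets letters. A tree of [X n] thus amounts to the set
    [I] of its painted gaps together with a function [u] on [0, ..., n] (zero at
    the centre [0], at the painted and at the half-painted gaps, and the rank of
    the unpainted level elsewhere) whose values form an initial segment. The
    tubing attached to it consists of the singletons [{i}], for [i] in [I], and
    of the sublevel sets of [u], which all contain the centre. Every tubing of
    the star has this form, since a tube is a singleton or contains the centre,
    tubes containing the centre form a chain, and [{i}] is compatible with
    exactly those of them that contain [i].

    Growth partitions are the fibres of a height function, and one refines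
    another iff the first height function orders the points more finely. Read
    off on [(I, u)], this is inclusion of tubings; conversely an inclusion is
    realised by a single growth step, which paints the new gaps on a second
    level. *)

From Stdlib Require Import Relation_Operators.
Require Import Defs.
From mathcomp Require Import all_boot zify.

Set Implicit Arguments.
Unset Strict Implicit.
Unset Printing Implicit Defensive.

(** * Trees and words *)

(** The inputs of a node sit in a nested list, so the induction hypothesis is supplied as a
    conjunction over that list. *)
Lemma tree_list_ind (P : Type) (Q : tree P -> Prop) :
  Q Leaf ->
  (forall l ts, foldr (fun t R => Q t /\ R) True ts -> Q (Node l ts)) ->
  forall t, Q t.
Proof.
move=> QL QN; fix IH 1 => -[|l ts]; first exact: QL.
by apply: QN; elim: ts => //= t ts IHts; split.
Qed.

(** The strict order that labels must follow along any path from the root upwards. Comparing painted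
    labels through [pickle] treats both kinds of trees at once: it is the order of levels over [nat]
    and is empty over [unit]. *)
Definition label_lt (P : countType) (l l' : label P) : bool :=
  match l, l' with
  | Painted p, Painted q => pickle p < pickle q
  | Painted _, _ => true
  | HalfPainted, Unpainted _ => true
  | Unpainted j, Unpainted k => j < k
  | _, _ => false
  end.

Lemma label_lt_irr (P : countType) : irreflexive (@label_lt P).
Proof. by case=> //= *; rewrite ltnn. Qed.

Lemma label_lt_trans (P : countType) : transitive (@label_lt P).
Proof. by case=> [p||j] [q||k] [r||m] //=; apply: ltn_trans. Qed.

Lemma label_lt_total (P : countType) (l l' : label P) :
  l != l' -> label_lt l l' || label_lt l' l.
Proof.
case: l l' => [p||j] [q||k] //=; rewrite -neq_ltn; apply: contraNN => /eqP.
  by move/(pcan_inj pickleK) ->.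
by move->.
Qed.

(** * Words of trees and the reconstruction of a tree from its word *)

Fixpoint join (A : Type) (l : A) (ss : seq (seq A)) : seq A :=
  if ss is s :: ss' then
    if ss' is [::] then s else s ++ l :: join l ss'
  else [::].

(** A gap between two consecutive inputs of a node ends at that node, so its label separates the
    words of the inputs. *)
Fixpoint word (P : Type) (t : tree P) : seq (label P) :=
  if t is Node l ts then join l (map (@word P) ts) else [::].

(** Planarity together with the increase of labels, phrased recursively through words;
    [ordered_upward] compares it with the formulation by addresses. *)
Fixpoint ordered (P : countType) (t : tree P) : bool :=
  if t is Node l ts then
    [&& 1 < size ts, all (@ordered P) ts
      & all (fun u => all (label_lt l) (word u)) ts]
  else true.

Lemma all_join (A : Type) (p : pred A) l ss :
  all p (join l ss) = ((size ss <= 1) || p l) && all (all p) ss.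
Proof.
elim: ss => //= s [|s' ss] IH; first by rewrite andbT.
rewrite all_cat /= IH /=; case: (p l) => /=; last by rewrite andbF.
by rewrite orbT.
Qed.

Lemma all_flatten (A : Type) (p : pred A) ss :
  all p (flatten ss) = all (all p) ss.
Proof. by elim: ss => //= s ss <-; rewrite all_cat. Qed.

Lemma has_join (A : Type) (p : pred A) l ss :
  has p (join l ss) = (1 < size ss) && p l || has (has p) ss.
Proof.
apply: negb_inj; rewrite negb_or negb_and -leqNgt -!all_predC all_join.
by congr (_ && _); apply: eq_all => s; rewrite /= all_predC.
Qed.

Lemma map_join (A B : Type) (f : A -> B) l ss :
  map f (join l ss) = join (f l) (map (map f) ss).
Proof. by elim: ss => //= s [|s' ss] IH //; rewrite map_cat /= IH. Qed.

Lemma join_cat (A : Type) (l : A) ss ss' : 0 < size ss -> 0 < size ss' ->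
  join l (ss ++ ss') = join l ss ++ l :: join l ss'.
Proof.
move=> + ss'_gt0; elim: ss => //= s [|s1 ss] IH _; first by case: ss' ss'_gt0 {IH}.
by move: IH => /= ->; rewrite // -catA.
Qed.

(** Nested joins with one separator collapse to a single join. This is the effect on words of
    contracting an edge between two nodes of the same label. *)
Lemma join_flatten (A : Type) (l : A) sss : all (fun ss => 0 < size ss) sss ->
  join l (flatten sss) = join l (map (join l) sss).
Proof.
elim: sss => //= ss [|ss' sss] IH /andP[ss0 sss0]; first by rewrite cats0.
rewrite join_cat ?IH //=; move: sss0 => /= /andP[+ _].
by rewrite size_cat; lia.
Qed.

(** Pieces are strictly shorter than the whole, which makes the fuel of [build] suffice. *)
Lemma size_join_gt (A : Type) (l : A) ss : 1 < size ss ->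
  all (fun s => size s < size (join l ss)) ss.
Proof.
have le : forall ss, all (fun s => size s <= size (join l ss)) ss.
  elim=> //= s [|s' {}ss] IH /=; first by rewrite leqnn.
  rewrite size_cat leq_addr; apply: sub_all IH => s1 /=; lia.
case: ss => // s [//|s' ss] _ /=; rewrite size_cat /= addnS ltnS leq_addr.
have := le (s' :: ss); apply: sub_all => s1 /=; lia.
Qed.

(** Left and right inverse of [join l] on nonempty lists of words avoiding [l]. The branch [[::
    [:: a]]] is a dummy, since [split] never returns the empty list. *)
Fixpoint split (A : eqType) (l : A) (w : seq A) : seq (seq A) :=
  if w is a :: w' then
    if a == l then [::] :: split l w'
    else if split l w' is s :: ss then (a :: s) :: ss else [:: [:: a]]
  else [:: [::]].

Lemma join_split (A : eqType) (l : A) w : join l (split l w) = w.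
Proof.
elim: w => //= a w; have [->|_] := eqVneq a l.
  by case: w => [|b w] //=; case: ifP => //= _ <-; case: (split l w).
by case: (split l w) => [|s [|s' ss]] <-.
Qed.

Lemma size_split (A : eqType) (l : A) w :
  size (split l w) = (count_mem l w).+1.
Proof.
elim: w => //= a w; case: (a == l) => /= [->//|].
by case: (split l w) => //= s ss [->].
Qed.

Lemma split_notin (A : eqType) (l : A) w :
  all (all (predC1 l)) (split l w).
Proof.
elim: w => //= a w; have [//|al] := eqVneq a l.
by case: (split l w) => [|s ss] /=; rewrite al.
Qed.

Lemma split_join (A : eqType) (l : A) ss : 0 < size ss ->
  all (all (predC1 l)) ss -> split l (join l ss) = ss.
Proof.
have splits s : all (predC1 l) s -> split l s = [:: s].
  by elim: s => //= a s IH /andP[/negPf-> /IH->].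
have split_cat s w : all (predC1 l) s -> split l (s ++ l :: w) = s :: split l w.
  by elim: s => /= [|a s IH]; [rewrite eqxx|move=> /andP[/negPf-> /IH->]].
elim: ss => //= s [|s' ss] IH _ /andP[ls lss]; first exact: splits.
by rewrite split_cat // IH.
Qed.

Fixpoint least (P : countType) (l : label P) (w : seq (label P)) : label P :=
  if w is l' :: w' then least (if label_lt l' l then l' else l) w' else l.

Lemma least_in (P : countType) (l : label P) w : least l w \in l :: w.
Proof.
elim: w l => [|l' w IH] l /=; first by rewrite inE.
by have := IH (if label_lt l' l then l' else l); rewrite !inE; case: ifP => _ /orP[]->;
  rewrite ?orbT.
Qed.

Lemma least_le (P : countType) (l : label P) w :
  all (fun x => ~~ label_lt x (least l w)) (l :: w).
Proof.
elim: w l => [|l' w IH] l /=; first by rewrite label_lt_irr.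
have /= := IH (if label_lt l' l then l' else l).
case: ifP => ll' /andP[lm ->]; rewrite andbT ?lm ?andbT /=.
  by apply: contraNN lm; apply: label_lt_trans.
apply: contraFN ll' => l'm; have [<-//|neq] := eqVneq (least l w) l.
have := label_lt_total neq; rewrite (negPf lm) orbF; exact: label_lt_trans.
Qed.

Lemma least_unique (P : countType) (l a : label P) w :
  l \in a :: w -> all (fun x => (x == l) || label_lt l x) (a :: w) ->
  least a w = l.
Proof.
move=> law /allP min_l; have /allP/(_ l law) := least_le a w.
by case/orP: (min_l _ (least_in a w)) => [/eqP|->].
Qed.

(** [k] is fuel: any bound on the length of the word. *)
Fixpoint build (P : countType) (k : nat) (w : seq (label P)) : tree P :=
  match k, w with
  | k'.+1, l :: w' =>
      let m := least l w' in Node m (map (build k') (split m w))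
  | _, _ => Leaf
  end.

Lemma mem_join_node (P : countType) l (ts : seq (tree P)) :
  1 < size ts -> l \in join l (map (@word P) ts).
Proof.
move=> ts1; rewrite -has_pred1 has_join size_map ts1 /=.
by rewrite eqxx.
Qed.

Lemma all_word (P : Type) (p : pred (label P)) (ts : seq (tree P)) :
  all (fun u => all p (word u)) ts = all (all p) (map (@word P) ts).
Proof. by rewrite all_map. Qed.

(** The root label is strictly below every letter of the inputs, so it is the least letter of the
    word and splitting there returns exactly the words of the inputs. *)
Lemma build_word (P : countType) k (t : tree P) :
  ordered t -> size (word t) <= k -> build k (word t) = t.
Proof.
elim/tree_list_ind: t k => [|l ts IH] k; first by case: k.
move=> /= /and3P[ts1 ots lts].
have := mem_join_node l ts1.
case def_w: (join _ _) => [//|a w] law.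
case: k => //= k; rewrite ltnS => wk.
have lmin : all (fun x => (x == l) || label_lt l x) (a :: w).
  rewrite -def_w all_join eqxx orbT /= all_map; apply: sub_all lts => u /=.
  by apply: sub_all => x /= ->; rewrite orbT.
rewrite (least_unique law lmin) -/(split l (a :: w)) -def_w split_join; first last.
- rewrite all_map; apply: sub_all lts => u; apply: sub_all => x /=.
  by apply: contraTneq => ->; rewrite label_lt_irr.
- by rewrite size_map ltnW.
have := @size_join_gt _ l (map (@word P) ts); rewrite size_map def_w /= all_map.
move=> /(_ ts1) small; congr Node.
elim: ts {ts1 def_w law lts lmin} IH ots small => //= t ts IHts [IHt /IHts{}IHts].
move=> /andP[ot /IHts{}IHts] /andP[st /IHts->]; rewrite IHt //; lia.
Qed.

(** After splitting at the least letter, the remaining letters differ from it and are not below it,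
    hence by totality lie above it. Every word is thus the word of an ordered tree. *)
Lemma buildP (P : countType) k (w : seq (label P)) :
  size w <= k -> ordered (build k w) /\ word (build k w) = w.
Proof.
elim: k w => [|k IH] [|a w] //; rewrite ltnS => wk.
rewrite /build -/build; set m := least a w; set ss := split m (a :: w).
have m_in : m \in a :: w := least_in a w.
have ss1 : 1 < size ss by rewrite size_split ltnS -has_count has_pred1.
have := @size_join_gt _ m ss ss1; rewrite join_split => small.
have {IH} ihP : all (fun s => ordered (build k s) && (word (build k s) == s)) ss.
  apply: sub_all small => s; rewrite /= ltnS => /leq_trans/(_ wk)/IH[-> ->].
  by rewrite eqxx.
have words : map (@word P) (map (build k) ss) = ss.
  rewrite -map_comp; apply: map_id_in => s /(allP ihP) /andP[_ /eqP//].
split; last by rewrite /= -/word words join_split.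
rewrite /ordered -/(@ordered P) size_map ss1 /= all_map; apply/andP; split.
  by apply: sub_all ihP => s /andP[].
rewrite all_word words.
have := least_le a w; rewrite -/m -[X in all _ X](join_split m) all_join => /andP[_ ge].
have := split_notin m (a :: w); rewrite -/ss => neq; apply/allP => s s_ss.
apply/allP => x x_s; have xm := allP (allP neq s s_ss) x x_s.
have := allP (allP ge s s_ss) x x_s; move: (label_lt_total xm) => /=.
by case: (label_lt x m).
Qed.

Lemma word_inj (P : countType) (t t' : tree P) :
  ordered t -> ordered t' -> word t = word t' -> t = t'.
Proof.
move=> ot ot' eq_w; rewrite -(build_word ot (leqnn _)) eq_w.
exact: build_word.
Qed.

(** * The forgetful map on words *)

Definition forget_label (l : label nat) : label unit :=
  match l with
  | Painted _ => Painted tt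
  | HalfPainted => HalfPainted
  | Unpainted k => Unpainted k
  end.

(** What [forget] substitutes for an input [u] of a painted node. *)
Definition painted_inputs (u : tree unit) : seq (tree unit) :=
  if u is Node (Painted _) us then us else [:: u].

Lemma forget_painted k ts : forget (Node (Painted k) ts) =
  Node (Painted tt) (flatten (map painted_inputs (map forget ts))).
Proof. by []. Qed.

Lemma painted_inputsP (u : tree unit) : ordered u ->
  [/\ 0 < size (painted_inputs u), all (@ordered unit) (painted_inputs u),
      all (fun v => all (label_lt (Painted tt)) (word v)) (painted_inputs u)
    & join (Painted tt) (map (@word unit) (painted_inputs u)) = word u].
Proof.
case: u => [|[[]||k] ts] //= /and3P[ts1 ots lts]; split; rewrite ?(ltnW ts1) //.
- by rewrite ts1 ots lts.
- rewrite andbT all_join /= orbT all_map; apply: sub_all lts => u.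
  by apply: sub_all; case.
- by rewrite ts1 ots lts.
- rewrite andbT all_join /= orbT all_map; apply: sub_all lts => u.
  by apply: sub_all; case.
Qed.

(** Contraction only merges joins whose separator has become [Painted tt] on both sides, so no
    letter moves and [forget] acts letter by letter. *)
Lemma forgetP (t : tree nat) : ordered t ->
  ordered (forget t) /\ word (forget t) = map forget_label (word t).
Proof.
elim/tree_list_ind: t => // l ts IH /and3P[ts1 ots lts].
have {IH} ihP : all (fun t => ordered (forget t) &&
    (word (forget t) == map forget_label (word t))) ts.
  elim: ts {ts1 lts} IH ots => //= t ts IHts [IHt /IHts{}IHts] /andP[/IHt[-> ->]].
  by rewrite eqxx.
have words : map (@word unit) (map forget ts) =
    map (map forget_label) (map (@word nat) ts).
  by elim: ts {ts1 ots lts} ihP => //= t ts IHts /andP[/andP[_ /eqP->] /IHts->].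
have oforget : all (@ordered unit) (map forget ts).
  by rewrite all_map; apply: sub_all ihP => t /andP[].
case: l lts => [k||k] lts.
- rewrite forget_painted; set us := map forget ts in words oforget *.
  have us1 : 1 < size us by rewrite size_map.
  clearbody us.
  have inputs_gt0 : all (fun vs => 0 < size vs) (map painted_inputs us).
    by rewrite all_map; apply: sub_all oforget => u /painted_inputsP[].
  split.
    rewrite /= !all_flatten !all_map; apply/and3P; split.
    + case: us us1 inputs_gt0 {words oforget} => [|u [|u' us]] //= _.
      by case/and3P; rewrite !size_cat; lia.
    + by apply: sub_all oforget => u /painted_inputsP[].
    + by apply: sub_all oforget => u /painted_inputsP[].
  rewrite /= map_flatten join_flatten; last first.
    rewrite !all_map; apply: sub_all oforget => u /painted_inputsP[].
    by rewrite /= size_map.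
  rewrite map_join -words; congr join; rewrite -!map_comp.
  elim: us oforget {us1 words inputs_gt0} => //= u us IHus /andP[ou /IHus->].
  by congr (_ :: _); have [] := painted_inputsP ou.
- rewrite /= map_join words size_map ts1 oforget all_word words !all_map.
  split=> //; apply: sub_all lts => t /=; rewrite all_map.
  by apply: sub_all; case.
- rewrite /= map_join words size_map ts1 oforget all_word words !all_map.
  split=> //; apply: sub_all lts => t /=; rewrite all_map.
  by apply: sub_all; case.
Qed.

(** * Addresses, levels and gaps *)

(** The common shape of [nodes] and [leaves], with the first index [m] left free so that induction
    on the list of inputs is possible. *)
Definition indexed_flatten (A B : Type) (f : nat -> A -> B) m (ss : seq (seq A)) :=
  flatten [seq [seq f c.1 a | a <- c.2] | c <- zip (iota m (size ss)) ss].

Lemma indexed_flatten_cons (A B : Type) (f : nat -> A -> B) m s ss :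
  indexed_flatten f m (s :: ss) = map (f m) s ++ indexed_flatten f m.+1 ss.
Proof. by []. Qed.

Lemma nodes_Node (P : Type) (l : label P) ts : nodes (Node l ts) = ([::], l) ::
  indexed_flatten (fun i v => (i :: v.1, v.2)) 0 (map (@nodes P) ts).
Proof. by []. Qed.

Lemma leaves_Node (P : Type) (l : label P) ts :
  leaves (Node l ts) = indexed_flatten cons 0 (map (@leaves P) ts).
Proof. by []. Qed.

Lemma mem_indexed_nodes (P : eqType) m i a (l : label P) ts :
  ((i :: a, l) \in indexed_flatten (fun i v => (i :: v.1, v.2)) m (map (@nodes P) ts)) =
  (m <= i < m + size ts) && ((a, l) \in nodes (nth Leaf ts (i - m))).
Proof.
elim: ts m => [|t ts IH] m; first by rewrite addn0; case: ltngtP.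
rewrite [map _ _]/= indexed_flatten_cons mem_cat IH.
have [->|neq] := eqVneq i m.
  rewrite ltnn andFb orbF leqnn subnn /= (_ : m < _) ?andTb; last by lia.
  by apply/mapP/idP => [[[b k] bk [-> ->]]|al] //; exists (a, l).
rewrite (_ : _ \in map _ _ = false); last first.
  by apply/mapP => -[v _ [im]]; rewrite im eqxx in neq.
rewrite addnS addSn !ltnS (ltn_neqAle m) eq_sym neq /=.
case: (ltnP m i) => [mi|]; last by rewrite leq_eqVlt (negPf neq); lia.
by rewrite -(subnSK mi).
Qed.

Lemma mem_nodes_cons (P : eqType) i a (l l' : label P) ts :
  ((i :: a, l') \in nodes (Node l ts)) =
  (i < size ts) && ((a, l') \in nodes (nth Leaf ts i)).
Proof. by rewrite nodes_Node inE mem_indexed_nodes add0n subn0. Qed.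

Lemma mem_nodes_root (P : eqType) (l l' : label P) ts :
  (([::], l') \in nodes (Node l ts)) = (l' == l).
Proof.
rewrite nodes_Node inE xpair_eqE eqxx /= orbC.
case: flattenP => // -[s /mapP[[i t] _ ->] /mapP[v _]] //.
Qed.

Lemma node_label_unique (P : eqType) (t : tree P) a l l' :
  (a, l) \in nodes t -> (a, l') \in nodes t -> l = l'.
Proof.
elim: a t => [|i a IH] [|k ts] //.
  by rewrite !mem_nodes_root => /eqP-> /eqP->.
by rewrite !mem_nodes_cons => /andP[_ +] /andP[_]; apply: IH.
Qed.

Lemma nth_all (A : Type) (p : pred A) x0 s i : all p s -> i < size s -> p (nth x0 s i).
Proof. by move=> /all_nthP; apply. Qed.

Lemma plane_ordered (P : countType) (t : tree P) : ordered t -> plane t.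
Proof.
elim/tree_list_ind: t => //= l ts IH /and3P[-> ots _] /=.
by elim: ts IH ots => //= t ts IHts [IHt /IHts{}IHts] /andP[/IHt-> /IHts->].
Qed.

Lemma tree_nth_ind (P : Type) (Q : tree P -> Prop) :
  Q Leaf ->
  (forall l ts, (forall i, i < size ts -> Q (nth Leaf ts i)) -> Q (Node l ts)) ->
  forall t, Q t.
Proof.
move=> QL QN; elim/tree_list_ind => // l ts IH; apply: QN.
by elim: ts IH => //= t ts IHts [Qt /IHts{}IHts] [|i] // /IHts.
Qed.

(** In a plane tree every node has two inputs, hence at least one gap ending at it, so each label
    occurs in the word. *)
Lemma mem_word (P : eqType) (t : tree P) l : plane t ->
  (l \in word t) <-> (exists a, (a, l) \in nodes t).
Proof.
elim/tree_nth_ind: t => [|k ts IH] pt; first by split=> // -[].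
have /andP[ts1 pts] : (1 < size ts) && all (@plane P) ts by [].
rewrite -has_pred1 has_join size_map ts1 /= has_map; split.
  case/orP=> [/eqP->|/(has_nthP Leaf)[i its]].
    by exists [::]; rewrite mem_nodes_root.
  rewrite /= has_pred1 => /(IH i its (nth_all _ pts its))[a al].
  by exists (i :: a); rewrite mem_nodes_cons its.
case=> -[|i a]; first by rewrite mem_nodes_root eq_sym => ->.
rewrite mem_nodes_cons => /andP[its al]; apply/orP; right.
apply/(has_nthP Leaf); exists i; rewrite //= has_pred1.
by apply/(IH i its (nth_all _ pts its)); exists a.
Qed.

Lemma upwardP (P : eqType) (r : rel (label P)) t :
  reflect (forall a b la lb, (a, la) \in nodes t -> (b, lb) \in nodes t ->
             strictly_above b a -> r la lb) (upward r t).
Proof.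
apply: (iffP allP) => [up a b la lb a_t b_t ab|up [a la] a_t].
  by have /allP/(_ _ b_t)/implyP := up _ a_t; apply.
by apply/allP => -[b lb] b_t; apply/implyP; apply: up.
Qed.

Lemma strictly_above_cons i j b a :
  strictly_above (j :: b) (i :: a) = (i == j) && strictly_above b a.
Proof.
rewrite /strictly_above /= eqseq_cons.
by case: (i == j).
Qed.

(** By [mem_word], the letters of the inputs of a node are the labels of all nodes strictly above
    it. *)
Lemma ordered_upward (P : countType) (t : tree P) :
  ordered t = plane t && upward (@label_lt P) t.
Proof.
elim/tree_nth_ind: t => // l ts IH.
rewrite [ordered _]/= [plane _]/= -andbA; case: (leqP (size ts) 1) => //= ts1.
apply/andP/andP => [[ots lts]|[pts /upwardP up]].
  have pts : all (@plane P) ts by apply: sub_all ots => u /plane_ordered.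
  split=> //; apply/upwardP => -[|i a] [|j b] la lb.
  - by rewrite /strictly_above.
  - rewrite mem_nodes_root mem_nodes_cons => /eqP-> /andP[jts b_t] _.
    have /allP := nth_all Leaf lts jts; apply.
    by apply/(mem_word _ (nth_all _ pts jts)); exists b.
  - by rewrite /strictly_above.
  - rewrite !mem_nodes_cons strictly_above_cons => /andP[its a_t] /andP[_ b_t].
    case/andP=> /eqP ij ab; subst j; have := nth_all Leaf ots its.
    by rewrite IH // => /andP[_ /upwardP/(_ a b)]; apply.
split; apply/(all_nthP Leaf) => i its.
  rewrite IH // (nth_all _ pts its); apply/upwardP => a b la lb a_t b_t ab.
  apply: (up (i :: a) (i :: b)); rewrite ?mem_nodes_cons ?its //.
  by rewrite strictly_above_cons eqxx.
apply/allP => l' /(mem_word _ (nth_all _ pts its))[a al'].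
apply: (up [::] (i :: a)); first by rewrite mem_nodes_root.
  by rewrite mem_nodes_cons its.
by rewrite /strictly_above.
Qed.

Lemma size_leaves (P : Type) (t : tree P) :
  plane t -> size (leaves t) = (size (word t)).+1.
Proof.
elim/tree_list_ind: t => // l ts IH /andP[/ltnW ts0 pts].
have {IH} : all (fun t => size (leaves t) == (size (word t)).+1) ts.
  elim: ts {ts0} IH pts => //= t ts IHts [IHt /IHts{}IHts].
  by case/andP=> /IHt-> /IHts->; rewrite eqxx.
rewrite leaves_Node [word _]/=; elim: ts ts0 0 {pts} => // t ts IH _ m.
move=> /= /andP[/eqP t_ok ts_ok].
rewrite indexed_flatten_cons size_cat size_map t_ok.
case: ts IH ts_ok => [|t' ts] IH ts_ok; first by rewrite addn0.
by rewrite IH //= size_cat /=; lia.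
Qed.

(** Letter [i], counted from [0], is the label of the node where gap [i.+1] ends. The induction runs
    over the inputs with a shifted first index; the gap lies inside the first input, after it, or on
    its border with the second. *)
Lemma gap_label (P : eqType) (t : tree P) l0 i : plane t -> i < size (word t) ->
  (common_prefix (nth [::] (leaves t) i) (nth [::] (leaves t) i.+1),
   nth l0 (word t) i) \in nodes t.
Proof.
elim/tree_list_ind: t i => // l ts IH i /andP[_ pts'].
have {pts'} pts : all (@plane P) ts := pts'.
rewrite leaves_Node nodes_Node [word _]/=.
elim: ts 0 i IH pts => // t ts IHts m i [IHt IH] /andP[pt pts].
have st := size_leaves pt; rewrite !map_cons !indexed_flatten_cons.
set L := indexed_flatten cons _ _; set N := indexed_flatten _ _ _.
have in_t : i < size (word t) ->
    (common_prefix (nth [::] (map (cons m) (leaves t) ++ L) i)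
       (nth [::] (map (cons m) (leaves t) ++ L) i.+1), nth l0 (word t) i)
    \in map (fun v => (m :: v.1, v.2)) (nodes t).
  move=> it; rewrite !nth_cat size_map st !ltnS it (ltnW it).
  rewrite !(nth_map [::]) ?st ?ltnS ?(ltnW it) //= eqxx.
  by apply/mapP; eexists; first exact: IHt pt it.
case: ts IHts IH pts @L @N in_t => [|t' ts] IHts IH pts L N in_t.
  by move=> it; rewrite inE mem_cat (in_t it) orbT.
rewrite [join _ _]/= size_cat /= => it.
case: (ltngtP i (size (word t))) => [lt_i|gt_i|eq_i].
- by rewrite [nth l0 _ _]nth_cat lt_i inE mem_cat in_t ?orbT.
- have [k def_i] : exists k, i = (size (word t)).+1 + k.
    by exists (i - (size (word t)).+1); rewrite subnKC.
  have := IHts m.+1 k IH pts; rewrite -/L -/N => /(_ _)/wrap[|].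
    by move: it; rewrite def_i /=; lia.
  have nthL q : nth [::] (map (cons m) (leaves t) ++ L) ((size (word t)).+1 + q) =
      nth [::] L q by rewrite nth_cat size_map st ltnNge leq_addr addKn.
  rewrite def_i -addnS !nthL => mem.
  rewrite [nth l0 _ _]nth_cat ltnNge leqW ?leq_addr // addSn subSn ?leq_addr //.
  rewrite addKn /= inE mem_cat; move: mem; rewrite inE.
  by case/orP=> ->; rewrite ?orbT.
(* On the border the two leaf addresses start with [m] and [m.+1], so their common prefix is the
   root. *)
- have [a [L' ->]] : exists a L', L = (m.+1 :: a) :: L'.
    move: pts => /andP[/size_leaves + _]; rewrite /L /= indexed_flatten_cons.
    by case: (leaves t') => // a s _; exists a; eexists.
  rewrite eq_i [nth l0 _ _]nth_cat ltnn subnn /= !nth_cat size_map st.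
  rewrite ltnS leqnn ltnn subnn (nth_map [::]) ?st //.
  by rewrite /= ltn_eqF // inE eqxx.
Qed.

Lemma gap_endP (P : eqType) (t : tree P) l0 l i : plane t ->
  0 < i <= size (word t) ->
  ((gap_end t i, l) \in nodes t) = (nth l0 (word t) i.-1 == l).
Proof.
case: i => // i pt /= it; have mem := gap_label l0 pt it.
by apply/idP/eqP => [/(node_label_unique mem)|<-].
Qed.

(** * Ordered partitions and their refinements *)

Definition initial (s : seq nat) := forall j k, j < k -> k \in s -> j \in s.

(** An initial set of naturals is determined by its cardinality, so the number of levels is a
    threshold for membership. *)
Lemma initial_mem s k :
  initial s -> (k < size (undup s)) = (k \in s).
Proof.
move=> ini; have sub i : i \in s -> i < size (undup s).
  move=> i_s; rewrite -[i.+1](size_iota 0); apply: uniq_leq_size; first exact: iota_uniq.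
  move=> j; rewrite mem_iota add0n mem_undup ltnS => /andP[_]; rewrite leq_eqVlt.
  by case/predU1P=> [->//|/ini]; apply.
apply/idP/idP => [ks|/sub//]; rewrite -mem_undup.
have /(uniq_min_size (undup_uniq s)) : {subset undup s <= iota 0 (size (undup s))}.
  by move=> i; rewrite mem_undup mem_iota => /sub.
by rewrite size_iota => /(_ (leqnn _))[_ ->]; rewrite mem_iota.
Qed.

Lemma initialP s :
  reflect (initial s) (perm_eq (undup s) (iota 0 (size (undup s)))).
Proof.
apply: (iffP idP) => [/perm_mem mem j k jk|ini].
  by rewrite -!(mem_undup s) !mem !mem_iota => /(ltn_trans jk).
apply: uniq_perm => [||k]; rewrite ?undup_uniq ?iota_uniq //.
by rewrite mem_undup mem_iota add0n initial_mem.
Qed.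

Lemma eq_initial s s' : s =i s' -> initial s -> initial s'.
Proof. by move=> ss' ini j k jk; rewrite -!ss'; apply: ini. Qed.

Lemma eq_nb_levels (P : Type) (lev : label P -> option nat) (t : tree P) s :
  levels lev t =i s -> nb_levels lev t = size (undup s).
Proof.
move=> eq_s; apply/perm_size/uniq_perm; rewrite ?undup_uniq // => k.
by rewrite !mem_undup.
Qed.

Lemma mem_levels (P : eqType) (lev : label P -> option nat) (t : tree P) :
  plane t -> levels lev t =i pmap lev (word t).
Proof.
move=> pt k; rewrite /levels !mem_pmap; apply/mapP/mapP => -[].
  move=> [a l] al lev_l; exists l => //; apply/(mem_word _ pt).
  by exists a.
by move=> l /(mem_word _ pt)[a al] lev_l; exists (a, l).
Qed.

Lemma upward_and (P : eqType) (r r' : rel (label P)) t :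
  upward (fun l l' => r l l' && r' l l') t = upward r t && upward r' t.
Proof.
apply/upwardP/andP => [up|[/upwardP up /upwardP up'] a b la lb a_t b_t ab].
  by split; apply/upwardP => a b la lb a_t b_t /(up _ _ _ _ a_t b_t)/andP[].
by rewrite (up a b) ?(up' a b).
Qed.

Lemma eq_upward (P : eqType) (r r' : rel (label P)) t :
  r =2 r' -> upward r t = upward r' t.
Proof.
by move=> rr'; apply: eq_all => v; apply: eq_all => w /=; rewrite rr'.
Qed.

(** Over [unit] no label lies below [Painted tt], so only the root can be painted. *)
Lemma ordered_count_painted (t : tree unit) : ordered t ->
  count (fun v => is_painted v.2) (nodes t) <= 1.
Proof.
case: t => // l ts; rewrite nodes_Node /= => /and3P[_ ots lts].
rewrite (eq_in_count (a2 := pred0)) ?count_pred0; first by case: (is_painted l).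
move=> [[|i a] l'].
  by move=> /flattenP[s /mapP[[i u] _ ->] /mapP[]].
rewrite mem_indexed_nodes add0n subn0 => /andP[its a_t].
have /allP/(_ l') := nth_all Leaf lts its.
case: l' a_t => [[]||k] a_t //= lt; have: label_lt l (Painted tt).
  by apply: lt; apply/mem_word; [exact/plane_ordered/nth_all|exists a].
by case: (l) => [[]||j] //=; rewrite ltnn.
Qed.

Lemma count_le1_painted (t : tree unit) a b :
  count (fun v => is_painted v.2) (nodes t) <= 1 ->
  (a, Painted tt) \in nodes t -> (b, Painted tt) \in nodes t -> a = b.
Proof.
move=> le1 a_t b_t; apply/eqP; apply: contraTT le1 => ab.
rewrite -ltnNge -size_filter.
apply: (@uniq_leq_size _ [:: (a, Painted tt); (b, Painted tt)]).
  by rewrite /= inE xpair_eqE (negPf ab).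
by move=> v; rewrite mem_filter !inE => /orP[] /eqP->; rewrite ?a_t ?b_t.
Qed.

(** [label_lt] over [unit] is a conjunction: the painting condition, the increase of unpainted
    levels, and the absence of a painted node above another. The last part matches the bound of one
    painted node. *)
Lemma in_XP n t : in_X n t <->
  [/\ ordered t, size (word t) = n & initial (pmap (@unpainted_level unit) (word t))].
Proof.
have lt_unit : @label_lt unit =2 fun l l' => ((is_painted l || is_unpainted l') &&
    match unpainted_level l, unpainted_level l' with
    | Some i, Some j => i < j | _, _ => true end) &&
    ~~ (is_painted l && is_painted l').
  by move=> [[]||j] [[]||k]; rewrite //= ?ltnn ?andbT.
split=> [/and4P[st /andP[pt up] c1 /andP[ini up']]|[ot st ini]].
  have ot : ordered t.
    rewrite ordered_upward pt (eq_upward _ lt_unit) !upward_and up up' /=.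
    apply/upwardP => a b [[]||i] [[]||j] //= a_t b_t.
    by rewrite (count_le1_painted c1 a_t b_t) /strictly_above eqxx andbF.
  split=> //; first by move: st; rewrite size_leaves // eqSS => /eqP.
  exact: eq_initial (mem_levels _ pt) (elimT (initialP _) ini).
have pt := plane_ordered ot; have := ot.
rewrite ordered_upward (eq_upward _ lt_unit) !upward_and => /and3P[_ /andP[up up'] _].
apply/and4P; split; first by rewrite size_leaves // st.
- by rewrite /painted_tree pt.
- exact: ordered_count_painted.
- rewrite /weak_order up' andbT; apply/initialP.
  by apply: eq_initial ini => k; rewrite mem_levels.
Qed.

(** Over [nat], [label_lt] is exactly the painting condition together with the increase of painted
    and of unpainted levels. *)
Lemma in_WP n t : in_W n t <->
  [/\ ordered t, size (word t) = n, initial (pmap painted_level (word t))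
    & initial (pmap (@unpainted_level nat) (word t))].
Proof.
have lt_nat : @label_lt nat =2 fun l l' => ((is_painted l || is_unpainted l') &&
    match painted_level l, painted_level l' with
    | Some i, Some j => i < j | _, _ => true end) &&
    match unpainted_level l, unpainted_level l' with
    | Some i, Some j => i < j | _, _ => true end.
  by move=> [i||j] [k||m]; rewrite //= ?andbT.
have lev_ini lev : plane t ->
    perm_eq (undup (levels lev t)) (iota 0 (nb_levels lev t)) <->
    initial (pmap lev (word t)).
  move=> pt; split=> [/initialP|ini]; first exact: eq_initial (mem_levels _ pt).
  by apply/initialP; apply: eq_initial ini => k; rewrite mem_levels.
rewrite /in_W /painted_tree /weak_order; split.
  case/and4P=> st /andP[pt up] /andP[ini up1] /andP[ini' up2].
  have ot : ordered t.
    by rewrite ordered_upward pt (eq_upward _ lt_nat) !upward_and up up1 up2.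
  split=> //; [|exact/lev_ini|exact/lev_ini].
  by move: st; rewrite size_leaves // eqSS => /eqP.
case=> ot st ini ini'; have := ot.
rewrite ordered_upward (eq_upward _ lt_nat) !upward_and.
case/and3P=> pt /andP[-> ->] ->; rewrite pt size_leaves // st eqxx /= !andbT.
by apply/andP; split; apply/lev_ini.
Qed.

(** * Refinement of ordered partitions given by height functions *)

Definition fibers (T : finType) (h : T -> nat) (N : nat) : seq {set T} :=
  [seq [set x | h x == k] | k <- iota 0 N].

Lemma sorted_filter_ltS (phi : nat -> nat) q (s : seq nat) :
  sorted (fun a b => phi a <= phi b) s ->
  [seq k <- s | phi k < q.+1] = [seq k <- s | phi k < q] ++ [seq k <- s | phi k == q].
Proof.
elim: s => //= a s IH; rewrite path_sortedE => [/andP[ge /IH->]|b c d]; last first.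
  exact: leq_trans.
case: (ltngtP (phi a) q) => a_q; rewrite ltnS ?(ltnW a_q) //= 1?leqNgt ?a_q ?leqnn //=.
rewrite ltnn (@eq_in_filter _ (fun k => phi k < q) pred0) ?filter_pred0 // => b.
by move/(allP ge) => /=; lia.
Qed.

(** Each block of [t] is the union of a consecutive run of blocks of [s], so initial runs of [t]
    have the same union as initial runs of [s]. *)
Lemma refines_prefix (T : finType) (s t : seq {set T}) : refines s t ->
  forall q, exists q', forall x,
    has (fun B : {set T} => x \in B) (take q t) =
    has (fun B : {set T} => x \in B) (take q' s).
Proof.
case=> r -> rt q; exists (size (flatten (take q r))) => x.
rewrite -{2}(cat_take_drop q r) flatten_cat take_size_cat //.
elim: r t q rt => [|c r IH] [|B t] [|q] //= /andP[/andP[_ /cover_partition <-] rt].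
rewrite has_cat -(IH t q rt); congr orb; rewrite /cover.
apply/bigcupP/hasP => [[C]|[C]]; first by rewrite inE; exists C.
by exists C; rewrite ?inE.
Qed.

Lemma has_fibers (T : finType) (h : T -> nat) N q x : h x < N ->
  has (fun B : {set T} => x \in B) (take q (fibers h N)) = (h x < q).
Proof.
move=> hN; rewrite -map_take has_map take_iota; apply/hasP/idP.
  by case=> k; rewrite mem_iota /= inE => + /eqP->; lia.
by move=> hq; exists (h x); rewrite ?mem_iota /= ?inE //; lia.
Qed.

(** Unions of initial runs of fibres are sublevel sets. Refinement makes each sublevel set of [h2]
    one of [h1]; conversely [h2] factors through [h1] by a monotone map, whose fibres group the
    blocks. *)
Lemma refines_fibers (T : finType) (h1 h2 : T -> nat) N1 N2 :
  (forall x, h1 x < N1) -> (forall x, h2 x < N2) ->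
  (forall k, k < N1 -> exists x, h1 x = k) ->
  refines (fibers h1 N1) (fibers h2 N2) <->
  (forall x y, h1 x <= h1 y -> h2 x <= h2 y).
Proof.
move=> lt1 lt2 onto1; split=> [ref x y xy|mono].
  have [q' q'P] := refines_prefix ref (h2 y).+1.
  have := q'P y; rewrite !has_fibers // ltnSn => /esym yq'.
  by have := q'P x; rewrite !has_fibers // ltnS => ->; apply: leq_ltn_trans yq'.
(* The factorization [h2 = phi \o h1]; taking a maximum over a sublevel set defines [phi] at every
   [k] and makes it monotone. *)
pose phi k := \max_(x | h1 x <= k) h2 x.
have phiE x : phi (h1 x) = h2 x.
  apply/eqP; rewrite eqn_leq /phi; apply/andP; split.
    by apply/bigmax_leqP => y; apply: mono.
  exact: (bigmax_sup x).
have phi_mono j k : j <= k -> phi j <= phi k.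
  move=> jk; apply/bigmax_leqP => x xj; apply: (bigmax_sup x) => //.
  exact: leq_trans jk.
pose fib k := [set x | h1 x == k].
exists [seq [seq fib k | k <- iota 0 N1 & phi k == j] | j <- iota 0 N2].
  have -> : flatten [seq [seq fib k | k <- iota 0 N1 & phi k == j] | j <- iota 0 N2] =
      map fib (flatten [seq [seq k <- iota 0 N1 | phi k == j] | j <- iota 0 N2]).
    by rewrite map_flatten -map_comp.
  congr map; have -> : flatten [seq [seq k <- iota 0 N1 | phi k == j] | j <- iota 0 N2] =
      [seq k <- iota 0 N1 | phi k < N2].
    elim: N2 {lt2} => [|q IH]; first by rewrite filter_pred0.
    rewrite -addn1 iotaD map_cat flatten_cat IH /= cats0 addn1 sorted_filter_ltS //.
    apply: sub_sorted (iota_ltn_sorted 0 N1) => j k jk; apply: phi_mono; exact: ltnW.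
  apply/esym/all_filterP/allP => k; rewrite mem_iota => /andP[_ /onto1[x <-]].
  by rewrite phiE.
rewrite /fibers; elim: (iota 0 N2) => //= j s ->; rewrite andbT.
apply/andP; split.
  (* Every value below [N1] is attained, so fibres are nonempty; this gives their distinctness here
     and excludes the empty block at the end. *)
  rewrite map_inj_in_uniq ?filter_uniq ?iota_uniq // => k k'.
  rewrite !mem_filter !mem_iota => /and3P[_ _ /onto1[x hx]] _ /setP/(_ x).
  by rewrite !inE hx eqxx => /esym/eqP.
apply/and3P; split.
- apply/eqP/setP => x; rewrite inE; apply/bigcupP/eqP => [[B]|hx].
    rewrite inE => /mapP[k]; rewrite mem_filter => /andP[/eqP <- _] ->.
    by rewrite inE => /eqP <-; rewrite phiE.
  exists (fib (h1 x)); rewrite inE // map_f // mem_filter phiE hx eqxx.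
  by rewrite mem_iota lt1.
- apply/trivIsetP => A B; rewrite !inE => /mapP[k _ ->] /mapP[k' _ ->] neq.
  rewrite -setI_eq0; apply/eqP/setP => x; rewrite !inE.
  by apply: contraNF neq => /andP[/eqP <- /eqP <-].
- rewrite inE; apply/mapP => -[k]; rewrite mem_filter mem_iota.
  by case/and3P=> _ _ /onto1[x hx] /setP/(_ x); rewrite !inE hx eqxx.
Qed.

(** * Tubings of the star *)

(** Every edge contains the centre: a set with the centre is connected through it, and one without
    it has no edge at all. *)
Lemma tube_St n (u : {set 'I_n.+1}) :
  @tube (St n) u = (ord0 \in u) || [exists i, u == [set i]].
Proof.
rewrite /tube /connected_in /=; case u0: (ord0 \in u) => /=.
  apply/andP; split; first by apply/set0Pn; exists ord0.
  apply/forall_inP => x xu; apply/forall_inP => y yu.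
  apply: (@connect_trans _ _ ord0).
    have [->|x0] := eqVneq x ord0; first exact: connect0.
    by apply: connect1; rewrite /star_adj /= xu u0 x0 ?eqxx ?orbT.
  have [->|y0] := eqVneq y ord0; first exact: connect0.
  by apply: connect1; rewrite /star_adj /= yu u0 y0 ?eqxx.
apply/andP/existsP => [[/set0Pn[i iu] /forall_inP/(_ i iu)/forall_inP conn]|[i /eqP->]].
  exists i; apply/eqP/setP => j; rewrite inE; apply/idP/eqP => [/conn|->//].
  case/connectP=> -[|k s] /=; first by move=> _ ->.
  case/andP=> /and3P[_ ku]; rewrite /star_adj /=.
  by case/orP=> /andP[] => [/eqP|_ /eqP] def0; rewrite ?def0 ?u0 in iu ku.
split; first by apply/set0Pn; exists i; rewrite inE.
apply/forall_inP => x; rewrite inE => /eqP->.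
by apply/forall_inP => y; rewrite inE => /eqP->.
Qed.

(** A union that contains the centre is a tube, so compatibility with a central tube can only be
    inclusion, whereas two distinct noncentral singletons are always compatible. *)
Lemma tubing_StP n (U : {set {set 'I_n.+1}}) :
  @tubing (St n) U <->
  [/\ [set: 'I_n.+1] \in U,
      forall B, B \in U -> (ord0 \in B) || [exists i, B == [set i]],
      forall B C, B \in U -> C \in U -> ord0 \in B -> ord0 \in C ->
        (B \subset C) || (C \subset B) &
      forall B i, B \in U -> [set i] \in U -> ord0 \in B -> i \in B].
Proof.
have compE B C : compatible (G := St n) B C =
    [|| B \subset C, C \subset B | [disjoint B & C] && ~~ tube (G := St n) (B :|: C)].
  by [].
split=> [/and3P[UT /forall_inP tubeU /forall_inP compU]|[UT tubeU chainU singU]].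
  split=> // [B /tubeU|B C BU CU B0 C0|B i BU iU B0]; first by rewrite tube_St.
    have /forall_inP/(_ C CU) := compU B BU; rewrite compE => /or3P[->|->|] //.
      by rewrite orbT.
    by rewrite tube_St inE B0 andbF.
  have /forall_inP/(_ _ iU) := compU B BU; rewrite compE tube_St inE B0 andbF orbF.
  by case/orP=> [/subsetP/(_ _ B0)|]; rewrite ?sub1set // inE => /eqP <-.
apply/and3P; split=> //; first by apply/forall_inP => B BU; rewrite tube_St tubeU.
apply/forall_inP => B BU; apply/forall_inP => C CU; rewrite compE.
have [B0|B0] := boolP (ord0 \in B); have [C0|C0] := boolP (ord0 \in C).
- by case/orP: (chainU B C BU CU B0 C0) => ->; rewrite ?orbT.
- have := tubeU C CU; rewrite (negPf C0) => /existsP[i /eqP Ci]; subst C.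
  by rewrite !sub1set (singU B i) ?orbT.
- have := tubeU B BU; rewrite (negPf B0) => /existsP[i /eqP Bi]; subst B.
  by rewrite !sub1set (singU C i).
have := tubeU B BU; rewrite (negPf B0) => /existsP[i /eqP Bi].
have := tubeU C CU; rewrite (negPf C0) => /existsP[j /eqP Cj].
subst B C; rewrite !sub1set !inE in B0 C0 *.
have [//|neq] := eqVneq i j; rewrite /= disjoints1 inE neq /=.
rewrite tube_St !inE (negPf B0) (negPf C0) /=.
apply/existsP => -[k /eqP/setP ijk]; have := ijk i; have := ijk j.
rewrite !inE !eqxx orbT /= => /esym/eqP jk /esym/eqP ik.
by rewrite jk ik eqxx in neq.
Qed.

(** * Tubings attached to pairs *)

Definition star_tubing n (I : {set 'I_n.+1}) (u : 'I_n.+1 -> nat) :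
    {set {set 'I_n.+1}} :=
  [set [set i] | i in I] :|: [set [set x | u x <= u i] | i in [set: 'I_n.+1]].

Lemma mem_star_tubing n (I : {set 'I_n.+1}) (u : 'I_n.+1 -> nat) B :
  B \in star_tubing I u <->
  (exists2 i, i \in I & B = [set i]) \/ (exists i, B = [set x | u x <= u i]).
Proof.
rewrite inE; split=> [/orP[/imsetP|/imsetP[i _ ->]]|[[i iI ->]|[i ->]]].
- by left.
- by right; exists i.
- by rewrite imset_f.
- by apply/orP; right; rewrite imset_f ?inE.
Qed.

Definition star_pair n (I : {set 'I_n.+1}) (u : 'I_n.+1 -> nat) : Prop :=
  [/\ ord0 \notin I, u ord0 = 0 & {in I, forall i, u i = 0}].

Lemma star_tubing_tubing n (I : {set 'I_n.+1}) (u : 'I_n.+1 -> nat) :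
  star_pair I u -> @tubing (St n) (star_tubing I u).
Proof.
case=> I0 u0 uI; apply/tubing_StP; split.
(* The universal tube is the sublevel set at a maximum of [u]. *)
- apply/mem_star_tubing; right; exists [arg max_(i > ord0) u i].
  by apply/setP => x; rewrite !inE; case: arg_maxnP => // i _ max_i; apply/esym/max_i.
- move=> B /mem_star_tubing[[i _ ->]|[i ->]]; last by rewrite inE u0.
  by apply/orP; right; apply/existsP; exists i.
- move=> B C /mem_star_tubing[[i iI ->]|[i ->]].
    by rewrite in_set1 => _ /eqP i0; rewrite i0 iI in I0.
  move=> /mem_star_tubing[[j jI ->] _|[j ->] _ _].
    by rewrite in_set1 => /eqP j0; rewrite j0 jI in I0.
  by case: (leqP (u i) (u j)) => ij; apply/orP; [left|right]; apply/subsetP => x;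
    rewrite !inE => /leq_trans; apply=> //; apply: ltnW.
- move=> B i /mem_star_tubing[[j jI ->]|[j ->]].
    by rewrite in_set1 => _ /eqP j0; rewrite j0 jI in I0.
  move=> /mem_star_tubing[[k kI /set1_inj->] _|[k ik] _].
    by rewrite inE uI.
  (* A singleton that is a sublevel set contains the centre, hence is [[set ord0]]. *)
  suff -> : i = ord0 by rewrite inE u0.
  by move/setP/(_ ord0): ik; rewrite !inE u0 leq0n => /eqP.
Qed.

Lemma star_tubing_sub n (I I' : {set 'I_n.+1}) (u u' : 'I_n.+1 -> nat) :
  star_pair I u -> star_pair I' u' ->
  (star_tubing I u \subset star_tubing I' u') <->
  (I \subset I' /\ forall x y, u' x <= u' y -> u x <= u y).
Proof.
case=> I0 u0 uI [I0' u0' uI']; split=> [/subsetP sub|[/subsetP subI mono]].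
  split.
    apply/subsetP => i iI; have /sub/mem_star_tubing : [set i] \in star_tubing I u.
      by apply/mem_star_tubing; left; exists i.
    case=> [[j jI' /set1_inj->]//|[j /setP/(_ ord0)]].
    by rewrite !inE u0' => /eqP i0; rewrite i0 iI in I0.
  move=> x y xy.
  have /sub/mem_star_tubing : [set z | u z <= u y] \in star_tubing I u.
    by apply/mem_star_tubing; right; exists y.
  case=> [[j jI' /setP/(_ ord0)]|[j /setP eqB]].
    by rewrite !inE u0 => /esym/eqP j0; rewrite j0 jI' in I0'.
  have := eqB x; rewrite !inE => ->; apply: (leq_trans xy).
  by have := eqB y; rewrite !inE leqnn => <-.
apply/subsetP => B /mem_star_tubing[[i iI ->]|[i ->]]; apply/mem_star_tubing.
  by left; exists i; first exact: subI.
(* The sublevel set of [u] is closed downwards for [u'], so it is the sublevel set of [u'] at its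
   [u']-highest point. *)
right; exists [arg max_(j > i | u j <= u i) u' j].
case: arg_maxnP => // j ji max_j; apply/setP => x; rewrite !inE.
by apply/idP/idP => [/max_j//|/mono/leq_trans]; apply.
Qed.

(** * The pair attached to a tubing *)

Section OfTubing.

Variables (n : nat) (U : {set {set 'I_n.+1}}).

(** The singleton of the centre is excluded: it counts among the central tubes. *)
Definition tubing_singles : {set 'I_n.+1} :=
  [set i | (i != ord0) && ([set i] \in U)].

(** The central tubes form a chain, and this is the position in it of the smallest one containing
    [i]. *)
Definition tubing_depth (i : 'I_n.+1) : nat :=
  #|[set B in U | (ord0 \in B) && (i \notin B)]|.

Lemma tubing_pair : @tubing (St n) U -> star_pair tubing_singles tubing_depth.
Proof.
case/tubing_StP=> UT tubeU chainU singU; split; first by rewrite inE eqxx.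
  by apply/eqP; rewrite cards_eq0 -subset0; apply/subsetP => B;
    rewrite !inE => /and3P[_ ->].
move=> i; rewrite inE => /andP[_ iU]; apply/eqP; rewrite cards_eq0 -subset0.
apply/subsetP => B; rewrite !inE => /and3P[BU B0] /negP[].
exact: singU iU B0.
Qed.

(** If [x] were outside [B], each central tube missing [y] would lie inside [B] and miss [x], and
    [B] itself would miss [x] but not [y], so [x] would be strictly deeper. *)
Lemma tubing_depth_closed B x y : @tubing (St n) U ->
  B \in U -> ord0 \in B -> y \in B -> tubing_depth x <= tubing_depth y -> x \in B.
Proof.
case/tubing_StP=> UT tubeU chainU singU BU B0 yB; apply: contraTT => xB.
rewrite -ltnNge; apply: proper_card; apply/properP; split.
  apply/subsetP => C; rewrite !inE => /and3P[CU C0 yC]; rewrite CU C0 /=.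
  case/orP: (chainU B C BU CU B0 C0) => /subsetP BC; first by rewrite BC in yC.
  by apply: contraNN xB; apply: BC.
by exists B; rewrite !inE BU B0 ?xB // negbK.
Qed.

(** Let [B] be the largest central tube missing [i], and [j] a deepest point of [B]. The central
    tubes missing [i] are [B] and those missing [j], so the depth of [j] is one less; iterating
    reaches [k]. *)
Lemma tubing_depth_initial i k : @tubing (St n) U ->
  k < tubing_depth i -> exists j, tubing_depth j = k.
Proof.
move=> tU; have [UT tubeU chainU singU] := (tubing_StP U).1 tU.
move: {2}(tubing_depth i) (leqnn (tubing_depth i)) => m.
elim: m i => [|m IH] i; first by rewrite leqn0 => /eqP->.
move=> im ki; have : [set B in U | (ord0 \in B) && (i \notin B)] != set0.
  by rewrite -card_gt0; apply: leq_ltn_trans ki.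
case/set0Pn=> B0 B0i.
have := @arg_maxnP _ B0 (fun B => B \in [set B in U | (ord0 \in B) && (i \notin B)])
  (fun B => #|B|) B0i.
case=> B; rewrite inE => /and3P[BU B_0 iB] max_B.
have maxB C : C \in [set B in U | (ord0 \in B) && (i \notin B)] -> #|C| <= #|B|.
  exact: max_B.
have := @arg_maxnP _ ord0 (fun x => x \in B) tubing_depth B_0.
case=> j jB max_j; suff ij : tubing_depth i = (tubing_depth j).+1.
  move: ki; rewrite ij ltnS leq_eqVlt => /predU1P[->|]; first by exists j.
  by apply: IH; rewrite -ltnS -ij.
rewrite /tubing_depth (cardsD1 B) !inE BU B_0 iB add1n; congr _.+1.
apply: eq_card => C; rewrite !inE.
apply/andP/and3P => [[CB /and3P[CU C0 iC]]|[CU C0 jC]].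
  split=> //; apply: contraNN CB => jC; rewrite eq_sym eqEcard maxB ?inE ?CU ?C0 //.
  rewrite andbT; apply/subsetP => x xB.
  exact: (tubing_depth_closed tU CU C0 jC (max_j x xB)).
split; first by apply: contraNneq jC => ->.
rewrite CU C0 /=; case/orP: (chainU B C BU CU B_0 C0) => /subsetP BC.
  by rewrite BC in jC.
by apply: contraNN iB; apply: BC.
Qed.

(** The sublevel set of the depth at [i] is the smallest central tube containing [i], and a central
    tube is the sublevel set at its deepest point. *)
Lemma star_tubingK : @tubing (St n) U ->
  star_tubing tubing_singles tubing_depth = U.
Proof.
move=> tU; have [UT tubeU chainU singU] := (tubing_StP U).1 tU.
apply/setP => B; apply/idP/idP => [/mem_star_tubing|BU].
  case=> [[i]|[i ->]]; first by rewrite inE => /andP[_ iU] ->.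
  have := @arg_minnP _ setT (fun C => [&& C \in U, ord0 \in C & i \in C])
    (fun C => #|C|).
  rewrite UT !inE => /(_ isT)[C /and3P[CU C0 iC] minC].
  suff -> : [set x | tubing_depth x <= tubing_depth i] = C by [].
  apply/setP => x; rewrite inE; apply/idP/idP => [|xC].
    exact: tubing_depth_closed tU CU C0 iC.
  apply/subset_leq_card/subsetP => D; rewrite !inE => /and3P[DU D0 xD].
  rewrite DU D0 /=; apply: contraNN xD => iD.
  case/orP: (chainU C D CU DU C0 D0) => /subsetP CD; first exact: CD.
  have /eqP-> // : D == C; rewrite eqEcard minC ?DU ?D0 // andbT.
  exact/subsetP.
apply/mem_star_tubing; have [B0|B0] := boolP (ord0 \in B); [right|left].
  have := @arg_maxnP _ ord0 (fun x => x \in B) tubing_depth B0.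
  case=> j jB max_j; exists j; apply/setP => x; rewrite inE.
  apply/idP/idP => [/max_j//|].
  exact: tubing_depth_closed tU BU B0 jB.
have := tubeU B BU; rewrite (negPf B0) => /existsP[i /eqP Bi]; exists i => //.
by move: B0; rewrite Bi !inE eq_sym => ->; rewrite -Bi BU.
Qed.

End OfTubing.

(** * The isomorphism *)

(** The centre [0] of the star stands for the half-painted level, which is always
    present; [i > 0] stands for gap [i]. *)
Definition star_label (P : Type) n (w : seq (label P)) (i : 'I_n.+1) : label P :=
  nth HalfPainted (HalfPainted :: w) i.

Definition star_word (P : Type) n (L : 'I_n.+1 -> label P) : seq (label P) :=
  [seq L (lift ord0 i) | i <- enum 'I_n].

Lemma size_star_word (P : Type) n (L : 'I_n.+1 -> label P) :
  size (star_word L) = n.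
Proof. by rewrite size_map size_enum_ord. Qed.

Lemma star_label_word (P : Type) n (L : 'I_n.+1 -> label P) i :
  L ord0 = HalfPainted -> star_label (star_word L) i = L i.
Proof.
move=> L0; case: (unliftP ord0 i) => [j|] ->; last by rewrite L0.
rewrite /star_label /= add0n (nth_map j) ?size_enum_ord ?ltn_ord //.
by rewrite nth_ord_enum.
Qed.

Lemma star_label_inj (P : Type) n (w w' : seq (label P)) :
  size w = n -> size w' = n ->
  (forall i : 'I_n.+1, star_label w i = star_label w' i) -> w = w'.
Proof.
move=> wn w'n eqL; apply: (@eq_from_nth _ HalfPainted); first by rewrite wn.
move=> i; rewrite wn => lt_i; exact: (eqL (Ordinal (lt_i : i.+1 < n.+1))).
Qed.

Lemma star_label_map (P Q : Type) n (f : label P -> label Q) w (i : 'I_n.+1) :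
  f HalfPainted = HalfPainted -> star_label (map f w) i = f (star_label w i).
Proof.
move=> f0; rewrite /star_label.
have -> : HalfPainted :: map f w = map f (HalfPainted :: w) by rewrite /= f0.
case: (ltnP i (size (HalfPainted :: w))) => iw; first exact: nth_map.
by rewrite !nth_default ?f0 ?size_map.
Qed.

Lemma mem_star_label (P : eqType) n (w : seq (label P)) l :
  size w = n -> l != HalfPainted ->
  l \in w <-> exists i : 'I_n.+1, star_label w i = l.
Proof.
move=> wn l0; split=> [/(nthP HalfPainted)[i iw <-]|[[[|i] lt_i] /=]].
- by rewrite wn in iw; exists (Ordinal (iw : i.+1 < n.+1)).
- by move=> eq_l; rewrite -eq_l eqxx in l0.
- by rewrite /star_label /= => <-; rewrite mem_nth // wn.
Qed.

(** The function [u] of the pair. Unpainted levels are shifted by one to leave [0] to the other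
    labels. *)
Definition depth (P : Type) (l : label P) : nat :=
  if l is Unpainted k then k.+1 else 0.

Definition depth_initial (P : Type) n (L : 'I_n.+1 -> label P) :=
  forall i k, k < depth (L i) -> exists j, depth (L j) = k.

(** The centre always has depth [0], so after the shift by one the two conditions agree. *)
Lemma initial_unpainted (P : eqType) n (w : seq (label P)) : size w = n ->
  initial (pmap (@unpainted_level P) w) <-> depth_initial (@star_label P n w).
Proof.
move=> wn; have mem k : k \in pmap (@unpainted_level P) w <->
    exists i : 'I_n.+1, depth (star_label w i) = k.+1.
  rewrite mem_pmap; split=> [/mapP[l /(mem_star_label wn)]|[i]].
    case: l => //= j mem [->]; have [i eq_i] := mem isT; exists i.
    by rewrite eq_i.
  case eq_i: (star_label w i) => [||j] //= -[jk]; apply/mapP.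
  exists (Unpainted j); last by rewrite /= jk.
  by apply/(mem_star_label wn) => //; exists i.
split=> [ini i [|k]|ini j k jk /mem[i eq_i]].
- by exists ord0.
- case eq_i: (depth (star_label w i)) => [//|m]; rewrite ltnS => km.
  by apply/mem; apply: (ini k m) => //; apply/mem; exists i.
- by apply/mem/(ini i); rewrite eq_i ltnS.
Qed.

Lemma initial_painted n (w : seq (label nat)) : size w = n ->
  (forall (i : 'I_n.+1) j k, j < k -> star_label w i = Painted k ->
     exists i' : 'I_n.+1, star_label w i' = Painted j) ->
  initial (pmap painted_level w).
Proof.
move=> wn ini j k jk; rewrite !mem_pmap.
case/mapP=> -[k'||//] // /(mem_star_label wn) mem [kk'].
have [i eq_i] := mem isT; subst k'.
have [i' eq_i'] := ini i j k jk eq_i; apply/mapP; exists (Painted j) => //.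
by apply/(mem_star_label wn) => //; exists i'.
Qed.

Lemma label_eqE (P : eqType) (l l' : label P) : (l == l') =
  match l, l' with
  | Painted p, Painted q => p == q
  | HalfPainted, HalfPainted => true
  | Unpainted j, Unpainted k => j == k
  | _, _ => false
  end.
Proof. by case: l l' => [p||j] [q||k]. Qed.

(** The index of the block in the growth partition when there are [p] painted levels; the
    half-painted block has index [p]. *)
Definition height (p : nat) (l : label nat) : nat :=
  match l with
  | Painted k => k
  | HalfPainted => p
  | Unpainted k => p + k.+1
  end.

Definition growth_height n (t : W n) (i : 'I_n.+1) : nat :=
  height (nb_levels painted_level (val t)) (star_label (word (val t)) i).

(** * Growth partitions as fibres of the height *)

Section GrowthPartition.

Variables (n : nat) (t : W n).

Let w := word (val t).
Let p := nb_levels painted_level (val t).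
Let m := nb_levels (@unpainted_level nat) (val t).
Let h := growth_height t.

Let hE i : h i = height p (star_label w i). Proof. by []. Qed.

Let wn : size w = n. Proof. by have /in_WP[] := valP t. Qed.

Let t_plane : plane (val t).
Proof. by have /in_WP[/plane_ordered] := valP t. Qed.

Lemma painted_lt k : k < p <-> exists i : 'I_n.+1, star_label w i = Painted k.
Proof.
have /in_WP[_ _ ini _] := valP t.
rewrite -(mem_star_label wn) // /p (eq_nb_levels (mem_levels _ t_plane)).
rewrite initial_mem // mem_pmap; split=> [/mapP[[j||j] //= jw [->]]//|kw].
by apply/mapP; exists (Painted k).
Qed.

Lemma unpainted_lt k : k < m <-> exists i : 'I_n.+1, star_label w i = Unpainted k.
Proof.
have /in_WP[_ _ _ ini] := valP t.
rewrite -(mem_star_label wn) // /m (eq_nb_levels (mem_levels _ t_plane)).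
rewrite initial_mem // mem_pmap; split=> [/mapP[[j||j] //= jw [->]]//|kw].
by apply/mapP; exists (Unpainted k).
Qed.

(** Here [p] is the height of the centre. With [height_depth], this recovers the pair from heights
    relative to the centre. *)
Lemma height_lt_painted i : (h i < p) = is_painted (star_label w i).
Proof.
rewrite hE; case eq_i: (star_label w i) => [k||k] /=; last by lia.
  by apply/painted_lt; exists i.
exact: ltnn.
Qed.

Lemma height_depth i : h i - p = depth (star_label w i).
Proof.
have := height_lt_painted i; rewrite hE.
by case: (star_label w i) => [k||k] /=; lia.
Qed.

Lemma height_lt i : h i < p + m.+1.
Proof.
have := height_lt_painted i; rewrite hE.
case eq_i: (star_label w i) => [k||k] /=; [lia|lia|] => _.
by rewrite ltn_add2l ltnS; apply/unpainted_lt; exists i.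
Qed.

Lemma height_onto k : k < p + m.+1 -> exists i, h i = k.
Proof.
case: (ltngtP k p) => [/painted_lt[i eq_i] _|pk km|->].
- by exists i; rewrite hE eq_i.
- have /unpainted_lt[i eq_i] : k - p.+1 < m by lia.
  by exists i; rewrite hE eq_i /=; lia.
- by exists ord0.
Qed.

Lemma mem_gaps_ending l i :
  (i \in gaps_ending n (val t) l) = (0 < i) && (star_label w i == l).
Proof.
rewrite inE; case: i => -[|i] //= lt_i.
by rewrite (gap_endP HalfPainted) ?wn.
Qed.

Lemma growth_partitionE : growth_partition n (val t) = fibers h (p + m.+1).
Proof.
rewrite /growth_partition -/p -/m /fibers iotaD add0n map_cat [iota p _]/= map_cons.
congr (_ ++ _ :: _).
- apply/eq_in_map => k; rewrite mem_iota /= add0n => kp; apply/setP => i.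
  rewrite mem_gaps_ending inE; have := height_lt_painted i; rewrite hE.
  case: i => -[|i] lt_i /=; first by rewrite /star_label /=; lia.
  by rewrite label_eqE; case: (star_label _ _) => [j||j] /=; lia.
- apply/setP => i; rewrite !inE; have := height_lt_painted i; rewrite hE.
  case: (eqVneq i ord0) => [->|i0]; first by rewrite /star_label /= eqxx.
  rewrite (_ : _ && _ = (star_label w i == HalfPainted)).
    by rewrite label_eqE; case: (star_label _ _) => [j||j] /=; lia.
  have := mem_gaps_ending HalfPainted i; rewrite inE => ->.
  by rewrite lt0n i0.
- rewrite -[p.+1]addn0 iotaDl -map_comp; apply: eq_map => k; apply/setP => i.
  rewrite mem_gaps_ending inE; have := height_lt_painted i; rewrite hE.
  case: i => -[|i] lt_i /=; first by rewrite /star_label /=; lia.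
  by rewrite label_eqE; case: (star_label _ _) => [j||j] /=; lia.
Qed.

End GrowthPartition.

Lemma growth_refines n (t s : W n) :
  refines (growth_partition n (val s)) (growth_partition n (val t)) <->
  (forall i j, growth_height s i <= growth_height s j ->
     growth_height t i <= growth_height t j).
Proof.
rewrite !growth_partitionE; apply: refines_fibers => *.
- exact: height_lt.
- exact: height_lt.
- exact: height_onto.
Qed.

(** * The tubing attached to a tree *)

Section TubingOfTree.

Variable n : nat.
Implicit Types x y : X n.

Definition tree_label x (i : 'I_n.+1) : label unit := star_label (word (val x)) i.

Definition tree_painted x : {set 'I_n.+1} := [set i | is_painted (tree_label x i)].

Definition tree_depth x (i : 'I_n.+1) : nat := depth (tree_label x i).

Lemma tree_pair x : star_pair (tree_painted x) (tree_depth x).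
Proof.
split; rewrite ?inE // => i; rewrite inE /tree_depth.
by case: (tree_label x i).
Qed.

Definition tree_tubing x : Tub (St n) :=
  exist _ (star_tubing (tree_painted x) (tree_depth x))
    (star_tubing_tubing (tree_pair x)).

Lemma tree_tubing_le x y : tub_le (tree_tubing y) (tree_tubing x) <->
  (tree_painted x \subset tree_painted y /\
   forall i j, tree_depth y i <= tree_depth y j -> tree_depth x i <= tree_depth x j).
Proof. exact: star_tubing_sub (tree_pair x) (tree_pair y). Qed.

Lemma tree_depth_initial x : depth_initial (tree_label x).
Proof. by apply/initial_unpainted; have /in_XP[] := valP x. Qed.

Lemma tree_label_inj x y : tree_label x =1 tree_label y -> x = y.
Proof.
move=> eq_xy; apply: val_inj.
have /in_XP[ox sx _] := valP x; have /in_XP[oy sy _] := valP y.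
exact: word_inj ox oy (star_label_inj sx sy eq_xy).
Qed.

(** Below a point of [u]-value [k.+1] there is one of [u]-value [k], and monotonicity forces [v] to
    be strictly smaller there. Applied both ways, it shows that a gap-free function is determined by
    the order it induces. *)
Lemma depth_le_of_mono (u v : 'I_n.+1 -> nat) :
  (forall i k, k < u i -> exists j, u j = k) ->
  (forall i j, v i <= v j -> u i <= u j) -> forall i, u i <= v i.
Proof.
move=> ini mono i; move: {2}(u i) (erefl (u i)) => k.
elim: k i => [|k IH] i ui; first by rewrite ui.
have [|j uj] := ini i k; first by rewrite ui.
rewrite ui; apply: (leq_ltn_trans (n := v j)); first by rewrite -uj IH.
by rewrite ltnNge; apply/negP => /mono; rewrite ui uj ltnn.
Qed.

Lemma tree_tubing_inj : injective tree_tubing.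
Proof.
move=> x y eq_xy.
have /tree_tubing_le[pxy dxy] : tub_le (tree_tubing y) (tree_tubing x).
  by rewrite eq_xy /tub_le.
have /tree_tubing_le[pyx dyx] : tub_le (tree_tubing x) (tree_tubing y).
  by rewrite eq_xy /tub_le.
have /setP eq_p : tree_painted x = tree_painted y by apply/eqP; rewrite eqEsubset pxy.
apply: tree_label_inj => i; have := eq_p i; rewrite !inE.
have : tree_depth x i = tree_depth y i.
  apply/eqP; rewrite eqn_leq !(depth_le_of_mono _ _) //; exact: tree_depth_initial.
rewrite /tree_depth.
by case: (tree_label x i) => [[]||j]; case: (tree_label y i) => [[]||k] //= [->].
Qed.

Lemma tree_of_label (L : 'I_n.+1 -> label unit) : L ord0 = HalfPainted ->
  depth_initial L -> {x : X n | tree_label x =1 L}.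
Proof.
move=> L0 ini; have sz := size_star_word L.
have [ot wt] := buildP (eq_leq sz).
have inX : in_X n (build n (star_word L)).
  apply/in_XP; split=> //; rewrite wt //; apply/(initial_unpainted sz) => i k.
  rewrite star_label_word // => /ini[j eq_j]; exists j.
  by rewrite star_label_word.
by exists (exist (in_X n) _ inX) => i; rewrite /tree_label /= wt star_label_word.
Qed.

Lemma tree_of_growth_label (L : 'I_n.+1 -> label nat) : L ord0 = HalfPainted ->
  depth_initial L ->
  (forall i j k, j < k -> L i = Painted k -> exists i', L i' = Painted j) ->
  exists2 t : W n, forall i, star_label (word (val t)) i = L i &
    forall x, (forall i, tree_label x i = forget_label (L i)) ->
      forget (val t) = val x.
Proof.
move=> L0 ini ini_p; have sz := size_star_word L.
have [ot wt] := buildP (eq_leq sz).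
have inW : in_W n (build n (star_word L)).
  apply/in_WP; split; rewrite ?wt //.
    apply: (initial_painted sz) => i j k jk; rewrite star_label_word //.
    by move/(ini_p _ _ _ jk) => [i' eq_i']; exists i'; rewrite star_label_word.
  apply/(initial_unpainted sz) => i k; rewrite star_label_word // => /ini[j eq_j].
  by exists j; rewrite star_label_word.
exists (exist (in_W n) _ inW) => [i|x eq_x] /=; first by rewrite wt star_label_word.
have [of_t wf_t] := forgetP ot; have /in_XP[ox sx _] := valP x.
apply: word_inj => //; apply: (@star_label_inj _ n) => [|//|i].
  by rewrite wf_t size_map wt sz.
by rewrite wf_t star_label_map // wt star_label_word // [RHS]eq_x.
Qed.

(** Stated with a [sig] type so that an inverse map can be extracted. *)
Lemma tree_tubing_surj U : {x | tree_tubing x = U}.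
Proof.
case: U => U tU; have [I0 u0 uI] := tubing_pair tU.
pose L i := if i \in tubing_singles U then Painted tt
  else if tubing_depth U i is k.+1 then Unpainted k else HalfPainted.
have depthL i : depth (L i) = tubing_depth U i.
  rewrite /L; case: ifP => [/uI->//|_]; by case: (tubing_depth U i).
have [||x eq_x] := @tree_of_label L.
- by rewrite /L (negPf I0) u0.
- move=> i k; rewrite depthL => /(tubing_depth_initial tU)[j <-].
  by exists j; rewrite depthL.
exists x; apply: val_inj; rewrite /= -[RHS](star_tubingK tU) /star_tubing.
have -> : tree_painted x = tubing_singles U.
  apply/setP => i; rewrite inE eq_x /L; case: ifP => // _.
  by case: (tubing_depth U i).
congr (_ :|: _); apply: eq_imset => i; apply/setP => j.
by rewrite !inE /tree_depth !eq_x !depthL.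
Qed.

Lemma forget_tree_label (t : W n) x : forget (val t) = val x ->
  forall i, tree_label x i = forget_label (star_label (word (val t)) i).
Proof.
move=> eq_x i; have /in_WP[/forgetP[_ wf] _ _ _] := valP t.
by rewrite /tree_label -eq_x wf star_label_map.
Qed.

Lemma growth_step_tubing x y : growth_step x y ->
  tub_le (tree_tubing y) (tree_tubing x).
Proof.
case=> t [s [tx sy /growth_refines mono]].
apply/tree_tubing_le.
have heightP (r : W n) z : forget (val r) = val z -> forall i,
    (i \in tree_painted z) = (growth_height r i < growth_height r ord0) /\
    tree_depth z i = growth_height r i - growth_height r ord0.
  move=> /forget_tree_label rz i; split.
    by rewrite [RHS]height_lt_painted inE rz; case: (star_label _ _).
  by rewrite [RHS]height_depth /tree_depth rz; case: (star_label _ _).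
split=> [|i j].
  apply/subsetP => i; rewrite (heightP t x tx i).1 (heightP s y sy i).1 !ltnNge.
  by apply: contraNN; apply: mono.
rewrite (heightP t x tx i).2 (heightP t x tx j).2.
rewrite (heightP s y sy i).2 (heightP s y sy j).2.
(* If [i] is strictly higher than [j] in [s], the inequality of depths puts [i] no higher than the
   centre, and comparison with [ord0] makes its depth in [x] zero. *)
have := mono i j; have := mono i ord0; lia.
Qed.

Lemma tubing_growth_step x y : tub_le (tree_tubing y) (tree_tubing x) ->
  growth_step x y.
Proof.
case/tree_tubing_le=> /subsetP subI mono.
(* The lift [t] of [x] has all painted gaps on one level. In the lift [s] of [y], the gaps painted
   in [x] stay on level [0] and the new ones go to level [1], or to level [0] if [x] has none, so
   that levels remain initial. *)
pose Lt i : label nat := match tree_label x i with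
  | Painted _ => Painted 0 | HalfPainted => HalfPainted | Unpainted k => Unpainted k end.
pose Ls i : label nat := match tree_label y i with
  | Painted _ => Painted (if i \in tree_painted x then 0 else tree_painted x != set0)
  | HalfPainted => HalfPainted | Unpainted k => Unpainted k end.
have depthLt i : depth (Lt i) = tree_depth x i.
  by rewrite /Lt /tree_depth; case: (tree_label x i).
have depthLs i : depth (Ls i) = tree_depth y i.
  by rewrite /Ls /tree_depth; case: (tree_label y i).
have [|||t tE forget_t] := @tree_of_growth_label Lt; first by [].
- move=> i k; rewrite depthLt => /tree_depth_initial[j eq_j].
  by exists j; rewrite depthLt.
- move=> i j k jk; rewrite /Lt; case: (tree_label x i) => // _ [k0].
  by rewrite -k0 in jk.
have [|||s sE forget_s] := @tree_of_growth_label Ls; first by [].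
- move=> i k; rewrite depthLs => /tree_depth_initial[j eq_j].
  by exists j; rewrite depthLs.
- move=> i j k jk; rewrite /Ls; case: (tree_label y i) => // _ [].
  case: ifP => [_ k0|_]; first by rewrite -k0 in jk.
  have [->/= k0|/set0Pn[i' i'x] k1] := eqVneq (tree_painted x) set0.
    by rewrite -k0 in jk.
  have j0 : j = 0 by move: jk; rewrite -k1; case: j.
  exists i'; have := subI _ i'x; rewrite inE.
  by case: (tree_label y i') => // -[] _; rewrite i'x j0.
exists t, s; split.
- by apply: forget_t => i; rewrite /Lt; case: (tree_label x i) => [[]||].
- by apply: forget_s => i; rewrite /Ls; case: (tree_label y i) => [[]||].
apply/growth_refines => i j ij.
have depth_t k : growth_height t k - growth_height t ord0 = tree_depth x k.
  by rewrite -depthLt -tE; apply: height_depth.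
have depth_s k : growth_height s k - growth_height s ord0 = tree_depth y k.
  by rewrite -depthLs -sE; apply: height_depth.
(* If [j] is painted in [x], its height in [s] is [0], which only gaps painted in [x] share, and
   these all have height [0] in [t]. Otherwise [j] is at least as high as the centre in [t], and
   comparing depths suffices. *)
have [jx|jx] := boolP (j \in tree_painted x).
  suff ix : i \in tree_painted x.
    by move: ix; rewrite inE /growth_height tE /Lt; case: (tree_label x i).
  have jy := subI j jx; have xn0 : tree_painted x != set0 by apply/set0Pn; exists j.
  have sj0 : growth_height s j = 0.
    move: jy; rewrite inE /growth_height sE /Ls jx.
    by case: (tree_label y j).
  have j_lt : growth_height s j < growth_height s ord0.
    rewrite [_ < _]height_lt_painted sE /Ls; move: jy; rewrite inE.
    by case: (tree_label y j).
  have i_lt := leq_ltn_trans ij j_lt; move: ij; rewrite sj0 leqn0.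
  rewrite [_ < _]height_lt_painted sE in i_lt; rewrite /growth_height sE.
  move: i_lt; rewrite /Ls; case: (tree_label y i) => //= _ _.
  by case: ifP => // _; rewrite xn0.
have j_ge : growth_height t ord0 <= growth_height t j.
  rewrite leqNgt [_ < _]height_lt_painted tE; move: jx; rewrite inE /Lt.
  by case: (tree_label x j).
have := mono i j; rewrite -!depth_s -!depth_t; lia.
Qed.

Lemma tree_tubing_bij : bijective tree_tubing.
Proof.
pose g U := sval (tree_tubing_surj U).
have gK : cancel g tree_tubing by move=> U; rewrite /g; case: tree_tubing_surj.
by exists g => // x; apply: tree_tubing_inj; rewrite gK.
Qed.

(** A growth step is already equivalent to inclusion of tubings, which is reflexive and transitive,
    so the closure adds nothing. *)
Lemma growth_le_tubing x y : growth_le y x <-> tub_le (tree_tubing y) (tree_tubing x).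
Proof.
split=> [|/tubing_growth_step]; last exact: rt_step.
elim=> [{}x {}y|{}x|{}x z {}y _ xz _ zy]; first exact: growth_step_tubing.
  exact: subxx.
exact: subset_trans xz zy.
Qed.

End TubingOfTree.

Theorem theorem4p15 (n : nat) (hn : 0 < n) :
  poset_isomorphic (@growth_le n) (@tub_le (St n)).
Proof.
exists (@tree_tubing n); first exact: tree_tubing_bij.
by move=> y x; apply: growth_le_tubing.
Qed.
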